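(* Let $N\geq 1$, $q$ a prime power and $k\in\{0,1,\dots,N-1\}$. Every higgledy-piggledy set of $k$-subspaces in $\mathrm{PG}(N,q)$ contains at least \[ \min\left\{q,\ \max\left\{(k+1)+\sum_{i=1}^{k+1}\left\lfloor\frac{N-k-1}{i}\right\rfloor,\ (N-k)+\sum_{i=1}^{N-k}\left\lfloor\frac{k}{i}\right\rfloor\right\}\right\}+1 \] elements.
   Context: $\mathrm{PG}(N,q)$ denotes the Desarguesian projective space of dimension $N$ over $\mathbb{F}_q$. For $k\in\{0,1,\dots,N-1\}$, a strong $k$-blocking set of $\mathrm{PG}(N,q)$ is a point set that meets every $(N-k)$-dimensional subspace $\kappa$ in a set of points spanning $\kappa$. A set $\mathcal{K}$ of $k$-subspaces of $\mathrm{PG}(N,q)$ is a higgledy-piggledy set if the set of all points lying in at least one element of $\mathcal{K}$ is a strong $k$-blocking set. *)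

(* Defs.v *)
(* PG(N,q) is the lattice of vector subspaces of F^(N+1), with F the
   field of q elements: a projective subspace of dimension d is a vector
   subspace of dimension d + 1, and points are vector lines. *)
From HB Require Import structures.
From mathcomp Require Import all_boot all_algebra.

Set Implicit Arguments.
Unset Strict Implicit.
Unset Printing Implicit Defensive.

(* A subspace of F^n is determined by its finite set of vectors, which makes
   {vspace 'rV[F]_n} a finite type. *)
Lemma vspace_setK (F : finFieldType) (n : nat) :
  cancel (fun U : {vspace 'rV[F]_n} => [set u | u \in U])
         (fun A : {set 'rV[F]_n} => <<enum A>>%VS).
Proof.
move=> U; apply/eqP; rewrite eqEsubv; apply/andP; split.
  by apply/span_subvP => u; rewrite mem_enum inE.
by apply/subvP => u Uu; apply: memv_span; rewrite mem_enum inE.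
Qed.

HB.instance Definition _ (F : finFieldType) (n : nat) :=
  CanIsCountable (@vspace_setK F n).
HB.instance Definition _ (F : finFieldType) (n : nat) : isFinite {vspace 'rV[F]_n} :=
  CanIsFinite (@vspace_setK F n).

Notation "''PG' ( N , F )" := {vspace 'rV[F]_N.+1}
  (at level 8, N at level 99, F at level 99, format "''PG' ( N ,  F )")
  : type_scope.

Section ProjectiveSpace.

Variables (F : finFieldType) (N : nat).
Implicit Types (U P kappa : 'PG(N, F)) (B K : {set 'PG(N, F)}).

Definition proj_subspace (d : nat) U : bool := \dim U == d.+1.

Definition proj_point U : bool := proj_subspace 0 U.

Definition point_set B : Prop := forall P, P \in B -> proj_point P.

Definition proj_span B : 'PG(N, F) := (\sum_(P in B) P)%VS.

Definition strong_blocking_set (k : nat) B : Prop :=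
  point_set B /\
  forall kappa, proj_subspace (N - k) kappa ->
    proj_span [set P in B | (P <= kappa)%VS] = kappa.

Definition covered_points K : {set 'PG(N, F)} :=
  [set P | proj_point P & [exists U in K, (P <= U)%VS]].

Definition higgledy_piggledy_set (k : nat) K : Prop :=
  (forall U, U \in K -> proj_subspace k U) /\
  strong_blocking_set k (covered_points K).

End ProjectiveSpace.

(* Main.v *)
Require Import Defs.
From HB Require Import structures.
From mathcomp Require Import all_boot all_algebra.
From mathcomp Require Import finfield zify.

(* If at most q subspaces of dimension k+1 in a vector space V of dimension
   n = N+1 are given, and some W of dimension n-k-1 satisfies U + W <> V for
   each of them, then the sums U + W do not cover V; for v outside all of them
   the subspace W + <v> contains no covered point outside W, so the given
   subspaces are not higgledy-piggledy. It remains to find W when there are few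
   subspaces. Choose a flag V > H_1 > ... > H_{k+1} = W with H_i of codimension
   i: the traces on H_{i-1} have dimension at least k+2-i, and H_i can be chosen
   to contain (k+2-i)-dimensional parts of floor((n-i)/(k+2-i)) of them, each
   of which then keeps a nonzero vector down to W. The second term of the
   maximum comes from the dual argument, with an increasing chain ending at W. *)

Set Implicit Arguments.
Unset Strict Implicit.
Unset Printing Implicit Defensive.

Import GRing.Theory.

Section Subspaces.

Variables (F : fieldType) (vT : vectType F).
Implicit Types (A B G H U W : {vspace vT}) (s : seq {vspace vT}).

Lemma dimv_add_line A v : v \notin A -> \dim (A + <[v]>)%VS = (\dim A).+1.
Proof.
move=> Av; apply/eqP; rewrite eqn_leq; apply/andP; split.
  by rewrite (leq_trans (dimv_add_leqif _ _)) // dim_vline -addn1 leq_add2l leq_b1.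
rewrite (ltn_leqif (dimv_leqif_sup (addvSl A <[v]>))).
by apply: contra Av => /subvP; apply; rewrite memvE addvSr.
Qed.

Lemma subv_dim_between A H d :
    (A <= H)%VS -> \dim A <= d <= \dim H ->
  exists2 B : {vspace vT}, (A <= B <= H)%VS & \dim B = d.
Proof.
move=> AH /andP[/subnKC <-]; elim: (d - \dim A) => [|e IHe] le_eH.
  by exists A; rewrite ?subvv ?addn0.
have [|B /andP[AB BH] dimB] := IHe; first by lia.
have /subvPn[v Hv Bv]: ~~ (H <= B)%VS.
  by apply/negP => /dimvS; lia.
exists (B + <[v]>)%VS; last by rewrite dimv_add_line // dimB addnS.
by rewrite (subv_trans AB (addvSl _ _)) subv_add BH -memvE.
Qed.

(** [A] is a sum of [d]-dimensional pieces, one chosen in each trace [U :&: H]. *)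
Lemma exists_small_subv_dim_cap s H d :
    {in s, forall U, d <= \dim (U :&: H)} ->
  exists A : {vspace vT}, [/\ (A <= H)%VS, \dim A <= size s * d
    & {in s, forall U, d <= \dim (U :&: A)}].
Proof.
elim: s => [|U s IHs] sH; first by exists 0%VS; rewrite sub0v dimv0.
have [U1 s_U1|A [AH dimA sA]] := IHs; first by apply: sH; rewrite inE s_U1 orbT.
have [||B /andP[_ BUH] dimB] := @subv_dim_between 0%VS (U :&: H)%VS d.
- exact: sub0v.
- by rewrite dimv0 sH ?mem_head.
have [BU BH] := (subv_trans BUH (capvSl _ _), subv_trans BUH (capvSr _ _)).
exists (B + A)%VS; split; first by rewrite subv_add BH.
  rewrite mulSn (leq_trans (dimv_add_leqif B A)) //.
  by rewrite dimB leq_add2l.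
move=> U1; rewrite inE => /predU1P[-> | /sA /leq_trans->//].
  by rewrite -dimB dimvS // subv_cap BU addvSl.
by rewrite dimvS // capvS // addvSr.
Qed.

(** Dually, [A] is an intersection of subspaces of codimension [d], one containing each [U + G];
    codimensions are subadditive under intersection. *)
Lemma exists_large_supv_dim_add s G d :
    {in s, forall U, \dim (U + G) + d <= dim vT} ->
  exists A : {vspace vT}, [/\ (G <= A)%VS, dim vT <= \dim A + size s * d
    & {in s, forall U, \dim (U + A) + d <= dim vT}].
Proof.
elim: s => [|U s IHs] sG.
  by exists fullv; rewrite subvf dimvf addn0.
have [U1 s_U1|A [GA dimA sA]] := IHs; first by apply: sG; rewrite inE s_U1 orbT.
have UGd := sG U (mem_head _ _).
have [||B /andP[UGB _] dimB] := @subv_dim_between (U + G)%VS fullv (dim vT - d).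
- exact: subvf.
- by rewrite dimvf; lia.
have [UB GB] := (subv_trans (addvSl _ _) UGB, subv_trans (addvSr _ _) UGB).
exists (B :&: A)%VS; split; first by rewrite subv_cap GB.
  have := dimv_sum_cap B A; have := dimvS (subvf (B + A)); rewrite dimvf /=.
  by lia.
move=> U1; rewrite inE => /predU1P[-> | /sA].
  have: (U + B :&: A <= B)%VS by rewrite subv_add UB capvSl.
  by move/dimvS; lia.
have: (U1 + B :&: A <= U1 + A)%VS by rewrite addvS // capvSr.
by move/dimvS; lia.
Qed.

(** Each level of the induction on [r] settles up to [m %/ i + 1] members of [s], where [i] is the
    current value of [r]; over i = r, ..., 1 these counts add up to the bound on [size s]. *)
Lemma exists_subv_meeting m r s H :
    \dim H = m.+1 + r ->
    size s <= r + \sum_(1 <= i < r.+1) m %/ i ->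
    {in s, forall U, r <= \dim (U :&: H)} ->
  exists W : {vspace vT}, [/\ (W <= H)%VS, \dim W = m.+1
    & {in s, forall U, 0 < \dim (U :&: W)}].
Proof.
elim: r s H => [|r IHr] s H dimH size_s sH.
  exists H; split=> //; first by rewrite dimH addn0.
  by move: size_s; rewrite big_geq // leqn0 size_eq0 => /eqP->.
(* c = floor((\dim H - 1) / r.+1) traces of dimension r.+1 fit in a hyperplane of H. *)
set c := (m %/ r.+1).+1.
have le_c: c * r.+1 <= m.+1 + r.
  by rewrite mulSn; have := leq_divM m r.+1; lia.
have [U /mem_take/sH//|A [AH dimA sA]] := @exists_small_subv_dim_cap (take c s) H r.+1.
have [|H' /andP[AH' H'H] dimH'] := @subv_dim_between A H (m.+1 + r) AH.
  rewrite dimH addnS leqnSn andbT (leq_trans dimA) // (leq_trans _ le_c) //.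
  by rewrite leq_mul2r size_take_min geq_minl orbT.
have [|U /mem_drop/sH|W [WH' dimW sW]] := IHr (drop c s) H' dimH'.
- by rewrite size_drop; move: size_s; rewrite big_nat_recr //= -/c /c; lia.
(* The other traces lose at most one dimension in the hyperplane [H'] of [H]. *)
- have := dimv_sum_cap (U :&: H) H'.
  have: (U :&: H + H' <= H)%VS by rewrite subv_add capvSr.
  by move/dimvS; rewrite -capvA (capv_idPr H'H); lia.
exists W; split=> // [|U]; first exact: subv_trans WH' H'H.
rewrite -{1}(cat_take_drop c s) mem_cat => /orP[/sA | /sW//].
(* For the first [c] members, the trace on [H'] has dimension at least [r.+1] while [W] has
   codimension [r] in [H'], so they meet nontrivially. *)
have := dimvS (capvS (subvv U) AH').
have := dimv_sum_cap (U :&: H') W.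
have: (U :&: H' + W <= H')%VS by rewrite subv_add capvSr.
by move/dimvS; rewrite -capvA (capv_idPr WH'); lia.
Qed.

Lemma exists_supv_not_spanning m r s G :
    \dim G + (m.+1 + r) = dim vT ->
    size s <= r + \sum_(1 <= i < r.+1) m %/ i ->
    {in s, forall U, \dim (U + G) + r <= dim vT} ->
  exists W : {vspace vT}, [/\ (G <= W)%VS, \dim W + m.+1 = dim vT
    & {in s, forall U, \dim (U + W) < dim vT}].
Proof.
elim: r s G => [|r IHr] s G dimG size_s sG.
  exists G; split; rewrite ?subvv -?dimG ?addn0 //.
  by move: size_s; rewrite big_geq // leqn0 size_eq0 => /eqP->.
set c := (m %/ r.+1).+1.
have le_c: c * r.+1 <= m.+1 + r.
  by rewrite mulSn; have := leq_divM m r.+1; lia.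
have [U /mem_take/sG//|A [GA dimA sA]] := @exists_large_supv_dim_add (take c s) G r.+1.
(* [A] has codimension at most [c * r.+1], which is less than that of [G]; this leaves room for one
   more dimension. *)
have [|G' /andP[GG' G'A] dimG'] := @subv_dim_between G A (\dim G).+1 GA.
  have: size (take c s) * r.+1 <= c * r.+1.
    by rewrite leq_mul2r size_take_min geq_minl orbT.
  by lia.
have [|||W [G'W dimW sW]] := IHr (drop c s) G'.
- by rewrite dimG' -dimG; lia.
- by rewrite size_drop; move: size_s; rewrite big_nat_recr //= -/c /c; lia.
- move=> U /mem_drop/sG.
  have := dimv_sum_cap (U + G) G'.
  have: (G <= (U + G) :&: G')%VS by rewrite subv_cap addvSr.
  by move/dimvS; rewrite -addvA (addv_idPr GG'); lia.
exists W; split=> // [|U]; first exact: subv_trans GG' G'W.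
rewrite -{1}(cat_take_drop c s) mem_cat => /orP[/sA | /sW//].
(* For the first [c] members, [U + G'] has codimension at least [r.+1], and [W] exceeds [G'] by only
   [r] dimensions. *)
have := dimvS (addvS (subvv U) G'A).
have := dimv_sum_cap (U + G') W.
have: (G' <= (U + G') :&: W)%VS by rewrite subv_cap addvSr.
by move/dimvS; rewrite -addvA (addv_idPr G'W); lia.
Qed.

End Subspaces.

(** Only nonzero vectors are counted: q proper subspaces cover at most q(q^(n-1) - 1) < q^n - 1 of
    them. Counting the shared zero vector each time would lose the case of exactly q subspaces. *)
Lemma exists_notin_proper_subspaces (F : finFieldType) n
    (s : seq {vspace 'rV[F]_n}) :
    size s <= #|F| -> {in s, forall U, \dim U < n} ->
  exists v, {in s, forall U : {vspace 'rV[F]_n}, v \notin U}.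
Proof.
case: n s => [|n] [|U0 s0] //; try by exists 0%R.
  by move=> _ /(_ U0 (mem_head _ _)).
move: (U0 :: s0) => s le_s sn; set q := #|F|.
have q_gt1: 1 < q := finNzRing_gt1 F.
pose C (s' : seq {vspace 'rV[F]_n.+1}) :=
  [set v : 'rV[F]_n.+1 | has (fun U : {vspace 'rV[F]_n.+1} => v \in U) s'].
have cardC: #|C s :\ 0%R| <= size s * (q ^ n).-1.
  elim: s {le_s} sn => [|U s IHs] sn /=.
    by rewrite leqn0 cards_eq0; apply/eqP/setP => v; rewrite !inE andbF.
  have ->: C (U :: s) :\ 0%R = [set v in U | v != 0%R] :|: C s :\ 0%R.
    by apply/setP => v; rewrite !inE /=; case: eqP; rewrite ?andbF ?andbT.
  rewrite mulSn (leq_trans (leq_card_setU _ _)) // leq_add //; last first.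
    by apply: IHs => U1 sU1; apply: sn; rewrite inE sU1 orbT.
  have: #|U| = (q ^ \dim U)%N := card_vspace U.
  rewrite (cardD1 0%R) mem0v => dimU.
  have ->: #|[set v in U | v != 0%R]| = (q ^ \dim U).-1.
    by rewrite -dimU; apply: eq_card => v; rewrite !inE andbC.
  by rewrite -!subn1 leq_sub2r // leq_pexp2l ?(ltnW q_gt1) // -ltnS sn ?mem_head.
have [v Cv]: exists v, v \notin C s.
  apply/existsP; rewrite -negb_forall; apply/negP => /forallP fullC.
  have: #|C s :\ 0%R| = (q ^ n.+1).-1.
    have := cardsD1 0%R (C s); rewrite fullC.
    have ->: C s = [set: 'rV[F]_n.+1] by apply/setP => v; rewrite fullC inE.
    by rewrite cardsT card_mx mul1n => ->.
  have := leq_mul le_s (leqnn (q ^ n).-1); rewrite expnS -/q.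
  have : 0 < q ^ n by rewrite expn_gt0 ltnW.
  by nia.
by exists v => U sU; apply: contra Cv => Uv; rewrite inE; apply/hasP; exists U.
Qed.

Lemma not_higgledy_piggledy (F : finFieldType) N k (K : {set 'PG(N, F)})
    (W : 'PG(N, F)) :
    k < N -> #|K| <= #|F| -> \dim W = N - k ->
    {in K, forall U, \dim (U + W) < N.+1} ->
  ~ higgledy_piggledy_set k K.
Proof.
move=> lt_kN leKF dimW KW [_ [_ spanK]].
have [v Wv Kv]: exists2 v, v \notin W & {in K, forall U : 'PG(N, F), v \notin (U + W)%VS}.
  (* A member [U0] makes [v \notin W] automatic, since [W] lies in [U0 + W]; adding [W] to the list
     instead could exceed q subspaces. Only an empty [K] needs [W] itself. *)
  have [K0 | [U0 KU0]] := set_0Vmem K.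
    have [||v Wv] := @exists_notin_proper_subspaces F N.+1 [:: W].
    - exact: ltnW (finNzRing_gt1 F).
    - by move=> U; rewrite inE => /eqP->; rewrite dimW; lia.
    exists v => [|U]; first by rewrite Wv ?mem_head.
    by rewrite K0 inE.
  have [||v Kv] := @exists_notin_proper_subspaces F N.+1 [seq (U + W)%VS | U in K].
  - by rewrite size_image.
  - by move=> _ /imageP[U KU ->]; apply: KW.
  exists v => [|U KU]; last by apply/Kv/image_f.
  by apply: contra (Kv _ (image_f _ KU0)); apply/subvP/addvSr.
pose kappa := (W + <[v]>)%VS.
have /spanK span_kappa: proj_subspace (N - k) kappa.
  by rewrite /proj_subspace dimv_add_line // dimW.
suff: (kappa <= W)%VS.
  by move/subvP/(_ v); rewrite (negPf Wv) memvE addvSr => /(_ isT).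
rewrite -span_kappa; apply/subv_sumP => P.
rewrite !inE => /andP[/andP[_ /exists_inP[U KU PU]] Pkappa].
apply/subvP => p Pp.
have /memv_addP[w Ww [_ /vlineP[c ->] def_p]] := subvP Pkappa p Pp.
(* A vector w + c v of [U] with c nonzero would put [v] in [U + W]. *)
have [c0 | nz_c] := eqVneq c 0%R; first by rewrite def_p c0 scale0r addr0.
case/negP: (Kv U KU).
have ->: v = (c^-1 *: (p - w))%R by rewrite def_p addrC addKr scalerK.
rewrite memvZ // memvB //; last by rewrite (subvP (addvSr U W)).
by rewrite (subvP (subv_trans PU (addvSl U W))).
Qed.

Theorem mainTheorem5 (N q k : nat) (F : finFieldType) (K : {set 'PG(N, F)}) :
  1 <= N -> #|F| = q -> k < N ->
  higgledy_piggledy_set k K ->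
  minn q (maxn ((k + 1) + \sum_(1 <= i < (k + 1).+1) (N - k - 1) %/ i)
               ((N - k) + \sum_(1 <= i < (N - k).+1) k %/ i)) + 1
  <= #|K|.
Proof.
move=> _ <- lt_kN hK; rewrite addn1 ltnNge leq_min.
apply/negP => /andP[leKq leK]; have dimK := hK.1.
have dimV: dim 'rV[F]_N.+1 = N.+1 by rewrite dim_matrix; exact: mul1n.
suff [W dimW KW] : exists2 W : 'PG(N, F),
    \dim W = N - k & {in K, forall U, \dim (U + W) < N.+1}.
  by case: (@not_higgledy_piggledy F N k K W).
move: leK; rewrite leq_max cardE => /orP[leK | leK].
  (* Since [\dim U + \dim W] = (k + 1) + (N - k) = N + 1, a nonzero intersection means that [U + W]
     is proper. *)
  have [|||W [_ dimW KW]] :=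
      @exists_subv_meeting _ _ (N - k - 1) (k + 1) (enum K) fullv.
  - by rewrite dimvf dimV; lia.
  - by [].
  - by move=> U; rewrite mem_enum capvf addn1 => /dimK/eqP->.
  exists W => [|U KU]; first by rewrite dimW; lia.
  have := dimv_sum_cap U W; have := KW U; rewrite mem_enum => /(_ KU).
  by rewrite (eqP (dimK U KU)) dimW; lia.
(* Here r = N - k is the codimension of every [U] in [K], so the chain can start at 0. *)
have [|||W [_ dimW KW]] :=
    @exists_supv_not_spanning _ _ k (N - k) (enum K) 0%VS.
- by rewrite dimv0 dimV; lia.
- by [].
- by move=> U; rewrite mem_enum addv0 dimV => /dimK/eqP->; lia.
exists W => [|U KU]; first by move: dimW; rewrite dimV; lia.
by have := KW U; rewrite dimV mem_enum; apply.
Qed.
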